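(* Let $R$ be a semi-local ring. Then the following conditions are equivalent: (1) $R$ is a GNC ring. (2) Either $R$ is a local ring with nil Jacobson radical, or $J(R)$ is nil and $R/J(R) \cong M_n(\mathbb{Z}_2)$ for some $n\ge 1$, or $R$ is a nil-clean ring.
   Context: Rings are associative with identity, not necessarily commutative. $J(R)$ is the Jacobson radical of $R$. $R$ is semi-local if $R/J(R)$ is semisimple Artinian. An element is nil-clean if it is the sum of an idempotent and a nilpotent element (not required to commute). A ring is nil-clean if all its elements are nil-clean, and GNC (generalized nil-clean) if all its non-units are nil-clean. $\mathbb{Z}_2=\mathbb{Z}/2\mathbb{Z}$, and $M_n$ denotes the $n\times n$ matrix ring. *)

(* Defs.v *)
From HB Require Import structures.
From mathcomp Require Import all_boot all_order all_algebra.
From mathcomp Require Import boolp classical_sets.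

Set Implicit Arguments.
Unset Strict Implicit.
Unset Printing Implicit Defensive.

Import GRing.Theory.

Local Open Scope classical_set_scope.
Local Open Scope ring_scope.

(* Rings are [pzRingType]s: associative, with identity, not necessarily       *)
(* commutative, and possibly zero.                                            *)

Section Elements.
Variable R : pzRingType.
Implicit Types x e q : R.

Definition two_sided_unit x := exists y, y * x = 1 /\ x * y = 1.

Definition idempotent e := e * e = e.

Definition nilpotent q := exists n : nat, q ^+ n = 0.

Definition nil_clean x :=
  exists e q, [/\ idempotent e, nilpotent q & x = e + q].

End Elements.

Definition nil_clean_ring (R : pzRingType) := forall x : R, nil_clean x.

Definition GNC_ring (R : pzRingType) :=
  forall x : R, ~ two_sided_unit x -> nil_clean x.

Section Ideals.
Variable R : pzRingType.
Implicit Types I K m : set R.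

Definition left_ideal I :=
  [/\ I 0, forall x y, I x -> I y -> I (x + y) & forall a x, I x -> I (a * x)].

Definition maximal_left_ideal m :=
  [/\ left_ideal m, m <> setT &
      forall I, left_ideal I -> m `<=` I -> I = m \/ I = setT].

(* A zero ring has no maximal left ideal, hence is not local. *)
Definition local_ring := exists! m, maximal_left_ideal m.

(* For a zero ring the intersection is empty-indexed, i.e. J(R) = R. *)
Definition jacobson_radical : {pred R} :=
  fun x => `[< forall m, maximal_left_ideal m -> m x >].

Definition nil_set (A : {pred R}) := forall x, x \in A -> nilpotent x.

(* The left regular module is semisimple: every submodule is a summand. *)
Definition semisimple_ring :=
  forall I, left_ideal I -> exists K,
    [/\ left_ideal K, I `&` K = [set 0] &
        forall x, exists a b, [/\ I a, K b & x = a + b]].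

Definition left_artinian_ring :=
  forall I : nat -> set R, (forall n, left_ideal (I n)) ->
    (forall n, I n.+1 `<=` I n) ->
    exists N, forall n, (N <= n)%N -> I n = I N.

(* The two conditions are left-right symmetric when taken together, and the   *)
(* first one already implies the second.                                      *)
Definition semisimple_artinian_ring := semisimple_ring /\ left_artinian_ring.

End Ideals.

Section JacobsonIdeal.
Variable R : pzRingType.
Local Notation J := (@jacobson_radical R).

Lemma left_idealN (I : set R) x : left_ideal I -> I x -> I (- x).
Proof. by move=> [_ _ IM] Ix; rewrite -mulN1r; apply: IM. Qed.

Lemma jacobson_zmod_closed : zmod_closed J.
Proof.
split=> [|x y /asboolP Jx /asboolP Jy]; apply/asboolP=> m mm.
  by have [[m0 _ _] _ _] := mm.
have [idm _ _] := mm; have [_ mD _] := idm.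
by apply: mD; [apply: Jx | apply: (left_idealN idm); apply: Jy].
Qed.

HB.instance Definition _ := GRing.isZmodClosed.Build R J jacobson_zmod_closed.

Lemma jacobsonMl a x : x \in J -> a * x \in J.
Proof.
move=> /asboolP Jx; apply/asboolP=> m mm.
by have [[_ _ mM] _ _] := mm; apply: mM; apply: Jx.
Qed.

(* If r is not in m then the left ideal (m : r) is again maximal. *)
Lemma maximal_left_ideal_colon (m : set R) r : maximal_left_ideal m ->
  ~ m r -> maximal_left_ideal [set x | m (x * r)].
Proof.
move=> [[m0 mD mM] mT mmax] mr; split.
- split=> /= [|x y mx my|a x mx]; first by rewrite mul0r.
    by rewrite mulrDl; apply: mD.
  by rewrite -mulrA; apply: mM.
- move=> eqT; apply: mr; have : [set x | m (x * r)] 1 by rewrite eqT.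
  by rewrite /= mul1r.
move=> K [K0 KD KM] mK.
pose L := [set z | exists k y, [/\ K k, m y & z = k * r + y]].
have idL : left_ideal L.
  split=> [|x y [k [u [Kk mu ->]]] [l [v [Kl mv ->]]]|a x [k [u [Kk mu ->]]]].
  - by exists 0, 0; split=> //; rewrite mul0r addr0.
  - exists (k + l), (u + v); split; [exact: KD|exact: mD|].
    by rewrite mulrDl addrACA.
  - exists (a * k), (a * u); split; [exact: KM|exact: mM|].
    by rewrite mulrDr mulrA.
have [z mz|Lm|LT] := mmax L idL.
- by exists 0, z; split=> //; rewrite mul0r add0r.
- left; apply/seteqP; split=> // k Kk /=; rewrite -Lm.
  by exists k, 0; split=> //; rewrite addr0.
right; apply/seteqP; split=> // a _.
have [k [y [Kk my rE]]] : L r by rewrite LT.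
have K1k : K (1 - k).
  by apply: mK; rewrite /= mulrBl mul1r {1}rE addrAC subrr add0r.
by rewrite -[a]mulr1 -(subrK k 1); apply: KM; apply: KD.
Qed.

Lemma jacobsonMr a x : x \in J -> x * a \in J.
Proof.
move=> /asboolP Jx; apply/asboolP=> m mm.
have [[m0 mD mM] _ _] := mm; have [ma|nma] := pselect (m a).
  exact: mM.
exact: Jx (maximal_left_ideal_colon mm nma).
Qed.

End JacobsonIdeal.

(* The library only equips quotients of commutative rings with a ring         *)
(* structure; here is the one on R / J(R), on top of the library's quotient   *)
(* of additive groups.                                                        *)
Section JacobsonQuotient.
Variable R : pzRingType.
Local Notation J := (@jacobson_radical R).
Local Open Scope quotient_scope.

Definition jquot : Type := Quotient.quot J.
HB.instance Definition _ := GRing.Zmodule.on jquot.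
HB.instance Definition _ := EqQuotient.on jquot.

Definition jproj (x : R) : jquot := \pi_jquot x.
Definition jmul (a b : jquot) : jquot := jproj (repr a * repr b).

Lemma jprojK (a : jquot) : jproj (repr a) = a.
Proof. exact: reprK. Qed.

Lemma jproj_eq x y : (jproj x = jproj y) <-> (x - y \in J).
Proof.
split=> [/eqP|Jxy]; first by rewrite /jproj -Quotient.idealrBE.
by apply/eqP; rewrite /jproj -Quotient.idealrBE.
Qed.

Lemma jprojD x y : jproj (x + y) = jproj x + jproj y.
Proof. exact: (@pi_addr _ _ _ _ _ (Quotient.quot J)). Qed.

Lemma jprojM x y : jproj (x * y) = jmul (jproj x) (jproj y).
Proof.
apply/jproj_eq; set x' := repr (jproj x); set y' := repr (jproj y).
have Jx : x - x' \in J by apply/jproj_eq; rewrite jprojK.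
have Jy : y - y' \in J by apply/jproj_eq; rewrite jprojK.
have -> : x * y - x' * y' = (x - x') * y + x' * (y - y').
  by rewrite mulrBl mulrBr addrA subrK.
by apply: rpredD; [apply: jacobsonMr | apply: jacobsonMl].
Qed.

Lemma jmulA : associative jmul.
Proof.
by move=> a b c; rewrite -[a]jprojK -[b]jprojK -[c]jprojK -!jprojM mulrA.
Qed.

Lemma jmul1r : left_id (jproj 1) jmul.
Proof. by move=> a; rewrite -[a]jprojK -jprojM mul1r. Qed.

Lemma jmulr1 : right_id (jproj 1) jmul.
Proof. by move=> a; rewrite -[a]jprojK -jprojM mulr1. Qed.

Lemma jmulDl : left_distributive jmul +%R.
Proof.
move=> a b c; rewrite -[a]jprojK -[b]jprojK -[c]jprojK.
by rewrite -jprojD -!jprojM -jprojD mulrDl.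
Qed.

Lemma jmulDr : right_distributive jmul +%R.
Proof.
move=> a b c; rewrite -[a]jprojK -[b]jprojK -[c]jprojK.
by rewrite -jprojD -!jprojM -jprojD mulrDr.
Qed.

HB.instance Definition _ :=
  GRing.Zmodule_isPzRing.Build jquot jmulA jmul1r jmulr1 jmulDl jmulDr.

HB.instance Definition _ := GRing.isZmodMorphism.Build R jquot jproj
  (fun x y => @pi_is_zmod_morphism _ _ _ (Quotient.quot J) x y).
HB.instance Definition _ := GRing.isMonoidMorphism.Build R jquot jproj
  (erefl, jprojM).

End JacobsonQuotient.

Definition semilocal_ring (R : pzRingType) := semisimple_artinian_ring (jquot R).

Definition ring_isomorphic (R S : pzRingType) :=
  exists f : {rmorphism R -> S}, bijective f.

(* Main.v *)
(* If J(R) is nil, idempotents lift modulo J(R), so R is nil-clean as soon as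
   S = R/J(R) is. When R is GNC, J(R) is nil and S is GNC. If S is not a division
   ring, every idempotent h <> 0 of S dominates an idempotent e <> 1 whose corner
   eSe is a division ring; its elements are non-units of S, hence nil-clean, and a
   rank-one element d of eSe that is nil-clean in S is 0 or e: thus eSe = F_2. The
   same holds in M_n(F_2), where e can be taken of rank one.
   Conversely, a semisimple S in which every idempotent h <> 0 dominates such an e
   is nil-clean: for x in hSh, the left ideal generated by the e x^i is Sg with
   gx = gxg, and x acts on it as a companion matrix of a polynomial
   X^n + X^k + (terms of degree < k), which is the sum of an idempotent and a
   nilpotent in a suitable basis. By block triangularity one passes to the smaller
   corner defined by h - g. *)
From mathcomp Require Import all_boot all_order all_algebra.
From mathcomp Require Import boolp classical_sets.
(* Imported last so that [idempotent] is not the notion of [ssrfun]. *)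
Require Import Defs.

Set Implicit Arguments.
Unset Strict Implicit.
Unset Printing Implicit Defensive.

Import GRing.Theory.
Local Open Scope classical_set_scope.
Local Open Scope ring_scope.

(** * Left ideals *)

Section RingGeneralities.
Variable R : pzRingType.
Implicit Types (e x y : R) (I : set R).

Lemma idempotentX e n : idempotent e -> e ^+ n.+1 = e.
Proof. by move=> ee; elim: n => // n IHn; rewrite exprS IHn. Qed.

Lemma idempotentB1 e : idempotent e -> idempotent (1 - e).
Proof.
by move=> ee; rewrite /idempotent mulrBl mul1r mulrBr mulr1 ee subrr subr0.
Qed.

Lemma nilpotent_fixed_eq0 x y : nilpotent x -> x * y = y -> y = 0.
Proof.
move=> [n xn0] xy; suff <- : x ^+ n * y = y by rewrite xn0 mul0r.
by elim: n {xn0} => [|n IHn]; rewrite ?mul1r // exprSr -mulrA xy.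
Qed.

Lemma nilpotentN x : nilpotent x -> nilpotent (- x).
Proof. by move=> [n xn0]; exists n; rewrite exprNn xn0 mulr0. Qed.

Lemma principal_left_ideal x : left_ideal [set y | exists a, y = a * x].
Proof.
split=> [|_ _ [a ->] [b ->]|a _ [b ->]]; first by exists 0; rewrite mul0r.
  by exists (a + b); rewrite mulrDl.
by exists (a * b); rewrite mulrA.
Qed.

Lemma left_ideal1 I : left_ideal I -> I 1 -> I = setT.
Proof.
by move=> [_ _ IM] I1; apply/seteqP; split=> // x _; rewrite -[x]mulr1;
  apply: IM.
Qed.

Lemma exists_maximal_left_ideal I : left_ideal I -> I <> setT ->
  exists2 m, maximal_left_ideal m & I `<=` m.
Proof.
move=> idI IT.
have nI1 : ~ I 1 by move=> /(left_ideal1 idI).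
(* Zorn on the traces [A] for which [A `|` I] is a proper left ideal, so that
   the empty chain causes no trouble. *)
pose P : set (set R) := [set A | left_ideal (A `|` I) /\ ~ (A `|` I) 1].
have [|m [[idm m1] mmax]] := @Zorn_bigcup _ P.
  move=> F FP totF; have [I0 ID IM] := idI; split; last first.
    by case=> // -[A FA A1]; have [_] := FP _ FA; apply; left.
  split=> [|x y|a x]; first by right.
    move=> [[A FA Ax]|Ix] [[B FB By]|Iy].
    - have [sAB|sBA] := totF _ _ FA FB.
        have [[_ BD _] _] := FP _ FB.
        have [Bxy|] := BD x y (or_introl (sAB _ Ax)) (or_introl By).
          by left; exists B.
        by right.
      have [[_ AD _] _] := FP _ FA.
      have [Axy|] := AD x y (or_introl Ax) (or_introl (sBA _ By)).
        by left; exists A.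
      by right.
    - have [[_ AD _] _] := FP _ FA.
      have [Axy|] := AD x y (or_introl Ax) (or_intror Iy).
        by left; exists A.
      by right.
    - have [[_ BD _] _] := FP _ FB.
      have [Bxy|] := BD x y (or_intror Ix) (or_introl By).
        by left; exists B.
      by right.
    - by right; apply: ID.
  move=> [[A FA Ax]|Ix]; last by right; apply: IM.
  have [[_ _ AM] _] := FP _ FA.
  by have [Axy|] := AM a x (or_introl Ax); [left; exists A | right].
exists (m `|` I); last by move=> x Ix; right.
split=> //; first by move=> mT; apply: m1; rewrite mT.
move=> K idK sK; have [K1|K1] := pselect (K 1).
  by right; apply: left_ideal1.
left; apply/seteqP; split=> // x Kx; apply: contrapT => nmx.
have KI : K `|` I = K.
  by apply/seteqP; split=> [y [//|Iy]|y Ky]; [apply: sK; right | left].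
apply: (mmax K); last by split; rewrite KI.
split; first by move=> y my; apply: sK; left.
by move=> sKm; apply: nmx; left; apply: sKm.
Qed.

Lemma left_inverse_of_maximal x :
  (forall m, maximal_left_ideal m -> ~ m x) -> exists y, y * x = 1.
Proof.
move=> nmx; apply: contrapT => nx.
have [|m mm sm] := exists_maximal_left_ideal (principal_left_ideal x).
  move=> xT; have [y yx] : [set y | exists a, y = a * x] 1 by rewrite xT.
  by apply: nx; exists y.
by apply: (nmx m mm); apply: sm; exists 1; rewrite mul1r.
Qed.

End RingGeneralities.

(** * The Jacobson radical *)

Section JacobsonRadical.
Variable R : pzRingType.
Implicit Types (a e q x y : R) (I : set R).
Local Notation J := (@jacobson_radical R).

Lemma jacobson_left_inverse x : x \in J -> exists y, y * (1 - x) = 1.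
Proof.
move=> /asboolP Jx; apply: left_inverse_of_maximal => m mm m1x.
have [idm mT _] := mm; apply: mT; apply: left_ideal1 => //.
by have [_ mD _] := idm; rewrite -(subrK x 1); apply: mD => //; apply: Jx.
Qed.

Lemma jacobson_idempotent_eq0 e : idempotent e -> e \in J -> e = 0.
Proof.
move=> ee /jacobson_left_inverse[y y1e].
by rewrite -[e]mul1r -y1e -mulrA mulrBl mul1r ee subrr mulr0.
Qed.

Lemma jproj_eq0 x : jproj x = 0 <-> x \in J.
Proof. by rewrite -[x in X in _ <-> X]subr0 -jproj_eq rmorph0. Qed.

(* [1 - (1 - a ^+ N) ^+ N] is a multiple of [a ^+ N], its complement is a
   multiple of [(1 - a) ^+ N], and all these elements commute. *)
Lemma idempotent_lift a : nil_set J ->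
  idempotent (jproj a) -> exists2 e : R, idempotent e & jproj e = jproj a.
Proof.
move=> nilJ aa.
have [n an0] : nilpotent (a * (1 - a)).
  apply/nilJ/jproj_eq0; rewrite rmorphM rmorphB rmorph1 /= mulrBr mulr1.
  by rewrite [_ * _]aa subrr.
(* A positive exponent, so that [idempotentX] collapses both powers modulo [J]. *)
pose N := n.+1; pose w := \sum_(i < N) a ^+ i.
pose w' := \sum_(i < N) (1 - a ^+ N) ^+ i.
have Ew : 1 - a ^+ N = (1 - a) * w.
  by rewrite -opprB subrX1 -mulNr opprB.
have Ew' : 1 - (1 - a ^+ N) ^+ N = a ^+ N * w'.
  by rewrite -opprB subrX1 -mulNr opprB opprB addrC subrK.
have cw : GRing.comm a w by apply: commr_sum => i _; exact: commrX.
have c1a : GRing.comm a (1 - a) by apply: commrB => //; exact: commr1.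
have cw' : GRing.comm a w'.
  by apply: commr_sum => i _; apply: commrX; apply: commrB;
     [exact: commr1 | exact: commrX].
pose e := 1 - (1 - a ^+ N) ^+ N.
have e1e : e * (1 - e) = 0.
  rewrite {2}/e opprB addrC subrK /e Ew' Ew exprMn_comm; last first.
    apply: commr_sum => i _; apply: commrX; apply/commr_sym.
    exact: c1a.
  rewrite -mulrA [w' * _]mulrA.
  have -> : w' * (1 - a) ^+ N = (1 - a) ^+ N * w'.
    apply: commrX; apply: commrB; first exact: commr1.
    exact/commr_sym.
  rewrite !mulrA -exprMn_comm // exprS an0.
  by rewrite mulr0 !mul0r.
exists e; first by move/eqP: e1e; rewrite mulrBr mulr1 subr_eq0 => /eqP.
rewrite /e rmorphB rmorphXn rmorphB rmorphXn rmorph1 /= !idempotentX //.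
  by rewrite subKr.
exact: idempotentB1.
Qed.

Lemma nil_clean_ring_lift :
  nil_set J -> nil_clean_ring (jquot R) -> nil_clean_ring R.
Proof.
move=> nilJ ncS x; have [e' [q' [ee' [n qn0] xE]]] := ncS (jproj x).
have [e ee eE] : exists2 e : R, idempotent e & jproj e = e'.
  by rewrite -(jprojK e') in ee' *; apply: idempotent_lift.
exists e, (x - e); split; rewrite // ?(addrC e) ?subrK //.
have [m qm0] : nilpotent ((x - e) ^+ n).
  by apply/nilJ/jproj_eq0; rewrite rmorphXn rmorphB /= eE xE addrC addKr.
by exists (n * m)%N; rewrite exprM.
Qed.

Lemma GNC_ring_jquot : GNC_ring R -> GNC_ring (jquot R).
Proof.
move=> gncR b nub; rewrite -(jprojK b) in nub *.
have [|e [q [ee [n qn0] ->]]] := gncR (repr b).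
  move=> [y [yx xy]]; apply: nub; exists (jproj y).
  by rewrite -!rmorphM yx xy rmorph1.
exists (jproj e), (jproj q); split; last exact: rmorphD.
  by rewrite /idempotent -rmorphM ee.
by exists n; rewrite -rmorphXn qn0 rmorph0.
Qed.

(** For a non-unit [x = e + q] in [J], the image of [e] is idempotent and equal to that of [- q], so
    it vanishes; and [0] is the only idempotent in [J]. *)
Lemma GNC_ring_nil_jacobson : GNC_ring R -> nil_set J.
Proof.
move=> gncR x Jx; have [[y [yx _]]|nux] := pselect (two_sided_unit x).
  exists 0; apply: jacobson_idempotent_eq0; first exact: mulr1.
  by rewrite expr0 -yx; apply: jacobsonMl.
have [e [q [ee nq xE]]] := gncR x nux.
suff e0 : e = 0 by rewrite xE e0 add0r.
apply: jacobson_idempotent_eq0 => //; apply/jproj_eq0.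
have eE : jproj e = - jproj q.
  by apply/eqP; rewrite -addr_eq0 -rmorphD -xE; apply/eqP/jproj_eq0.
apply: (@nilpotent_fixed_eq0 _ (jproj e)); last by rewrite -rmorphM ee.
rewrite eE; apply: nilpotentN.
by have [n qn0] := nq; exists n; rewrite -rmorphXn qn0 rmorph0.
Qed.

(** Elements outside the unique maximal left ideal have left inverses. A left inverse of [x] is
    again outside, as [J] is two-sided, so it has a left inverse too, necessarily [x]. *)
Lemma local_ring_unit_or_jacobson x :
  local_ring R -> two_sided_unit x \/ x \in J.
Proof.
move=> [m [mm m_uniq]].
have nJ y : y \notin J -> exists z, z * y = 1.
  move=> nJy; apply: left_inverse_of_maximal => m' mm' m'y.
  move/negP: nJy; apply; apply/asboolP => m'' mm''.
  by rewrite -(m_uniq _ mm'') (m_uniq _ mm').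
have [Jx|/nJ[y yx]] := boolP (x \in J); [by right | left].
have [|z zy] := nJ y.
  apply/negP => Jy; have [idm mT _] := mm; apply: mT; apply: left_ideal1 => //.
  by have /asboolP := jacobsonMr x Jy; rewrite yx; apply.
exists y; split=> //.
by rewrite -[x]mul1r -{1}zy -(mulrA z) yx mulr1 zy.
Qed.

Lemma local_ring_GNC : local_ring R -> nil_set J -> GNC_ring R.
Proof.
move=> locR nilJ x nux; have [//|Jx] := local_ring_unit_or_jacobson x locR.
by exists 0, x; split; [exact: mulr0 | exact: nilJ | rewrite add0r].
Qed.

Lemma division_jquot_local :
  (1 : jquot R) <> 0 ->
  (forall a : jquot R, a <> 0 -> exists b : jquot R, b * a = 1) ->
  local_ring R.
Proof.
move=> one_neq0 divS; pose I : set R := [set x | x \in J].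
have idI : left_ideal I.
  by split=> [|x y|a x]; [exact: rpred0 | exact: rpredD | exact: jacobsonMl].
have IT : I <> setT.
  by move=> IT; apply: one_neq0; apply/(jproj_eq0 1); have : I 1 by rewrite IT.
have maxI K : left_ideal K -> I `<=` K -> K <> setT -> I = K.
  move=> idK sIK KT; apply/seteqP; split=> // x Kx; apply: contrapT => nIx.
  have [|b bx] := divS (jproj x); first by move/jproj_eq0.
  apply: KT; apply: left_ideal1 => //; have [_ KD KM] := idK.
  rewrite -(subrK (repr b * x) 1); apply: KD; last exact: KM.
  apply: sIK; apply/jproj_eq.
  by rewrite rmorphM rmorph1 /= [jproj (repr b)]jprojK.
exists I; split.
  split=> // K idK sIK; have [|KT] := pselect (K = setT); first by right.
  by left; apply/esym/maxI.
move=> m mm; have [idm mT _] := mm; apply: maxI => //.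
by move=> x /asboolP; apply.
Qed.

End JacobsonRadical.
(** * Semisimple rings and division corners *)

Section SemisimpleRings.
Variable S : pzRingType.
Implicit Types (d e f h q w x y z : S) (I : set S).

(** The component [a] of [1] along [I] serves: for [x] in [I], the product of [x] with the other
    component lies both in [I] and in its complement. *)
Lemma semisimple_right_unit I : semisimple_ring S -> left_ideal I ->
  exists2 a, I a & forall x, I x -> x * a = x.
Proof.
move=> ssS idI; have [K [[K0 KD KM] IK decS]] := ssS I idI.
have [_ ID IM] := idI; have [a [b [Ia Kb ab1]]] := decS 1.
exists a => // x Ix; have xb : x * b = x - x * a.
  by rewrite -{2}[x]mulr1 ab1 mulrDr addrC addKr.
apply/esym/eqP; rewrite -subr_eq0 -xb; apply/eqP.
suff : [set 0 : S] (x * b) by [].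
rewrite -IK; split; last exact: KM.
by rewrite xb; apply: ID => //; apply: left_idealN => //; apply: IM.
Qed.

Lemma semisimple_regular z : semisimple_ring S -> exists a, z * a * z = z.
Proof.
move=> ssS; have idz := principal_left_ideal z.
have [_ [a ->] za] := semisimple_right_unit ssS idz.
by exists a; rewrite -mulrA; apply: za; exists 1; rewrite mul1r.
Qed.

(** An infinite descent through strictly smaller idempotents would make the left ideals that they
    generate decrease forever. *)
Lemma idempotent_ind (P : S -> Prop) : left_artinian_ring S ->
  (forall h, idempotent h ->
     (forall f, idempotent f -> f * h = f -> h * f = f -> f <> h -> P f) ->
     P h) ->
  forall h, idempotent h -> P h.
Proof.
move=> artS IH h0 h0h0; apply: contrapT => nP0.
pose bad h := idempotent h /\ ~ P h.
have /choice[F FP] : forall h, exists f,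
    bad h -> [/\ bad f, f * h = f, h * f = f & f <> h].
  move=> h; have [[hh nPh]|] := pselect (bad h); last by exists h.
  apply: contrapT => nf; apply: nPh; apply: IH => // f ff fh hf fneh.
  by apply: contrapT => nPf; apply: nf; exists f.
pose u n := iter n F h0.
have badu n : bad (u n) by elim: n => // n /FP[].
pose I n : set S := [set x | x * u n = x].
have [n|n x xu|N IN] := artS I.
- rewrite /I; split=> /= [|x y xu yu|a x xu]; first by rewrite mul0r.
    by rewrite mulrDl xu yu.
  by rewrite -mulrA xu.
- by rewrite /I /= -xu -mulrA; have [_ -> _ _] := FP _ (badu n).
have [_ _ uFu uneq] := FP _ (badu N); apply: uneq.
have : I N.+1 (u N) by rewrite IN //; have [] := badu N.
by rewrite /I /= uFu.
Qed.

(** For [e] idempotent, this is membership in the corner ring [e S e]. *)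
Definition corner e x := e * x = x /\ x * e = x.

Definition division_corner e :=
  forall z, corner e z -> z <> 0 ->
    exists w, [/\ corner e w, w * z = e & z * w = e].

(** Cancelling [z] by its inverse leads to [e = 0]. The factor [e] matters at exponent [0], where
    the power is [1] and not the identity of the corner. *)
Lemma division_corner_nilpotent e z n :
  division_corner e -> corner e z -> e * z ^+ n = 0 -> z = 0.
Proof.
move=> dive ez ezn0; apply: contrapT => z0.
have [w [_ wz _]] := dive z ez z0; apply: z0; have [<- _] := ez.
suff -> : e = 0 by rewrite mul0r.
elim: n ezn0 => [|n IHn]; rewrite ?mulr1 // exprS mulrA => ezn0.
by apply: IHn; have [ez' _] := ez; rewrite -wz -mulrA -{1}ez' ezn0 mulr0.
Qed.

(* Over a division ring [D], a matrix of rank one with eigenvalue [d <> 0] that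
   is the sum of an idempotent [f] and a nilpotent [q]: on its column space
   [f] has rank at most one, and if [u] spans the image of [f] there, then [q]
   preserves the span of [e] and [u]. *)
Lemma nil_clean_division_corner e d : idempotent e -> division_corner e ->
  corner e d -> nil_clean d -> d = 0 \/ d = e.
Proof.
move=> ee dive cd [f [q [ff nq dE]]].
have [ed de] := cd.
have qE x : q * x = d * x - f * x by rewrite dE mulrDl addrC addKr.
have [d0|d0] := pselect (d = 0); [by left | right].
(* Multiplication by [e] is injective on the image of [f]: if [e] kills [f * x], then so does
   [d = d * e], and [- q] fixes [f * x]. *)
have f_inj x : e * f * x = 0 -> f * x = 0.
  move=> efx; apply: (@nilpotent_fixed_eq0 _ (- q)); first exact: nilpotentN.
  have dfx : d * (f * x) = 0 by rewrite -de -mulrA (mulrA e) efx mulr0.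
  by rewrite mulNr qE dfx sub0r opprK mulrA ff.
pose l := e * f * e.
have cl : corner e l by rewrite /corner /l !mulrA ee -!mulrA ee.
have [l0|l0] := pselect (l = 0).
  (* Here [q] acts on [e] as [d] does, so [d] is nilpotent. *)
  have fe : f * e = 0 by apply: f_inj.
  have qe : q * e = d by rewrite qE fe de subr0.
  have qne n : q ^+ n * e = e * d ^+ n.
    elim: n => [|n IHn]; first by rewrite mul1r mulr1.
    by rewrite exprSr -mulrA qe -{1}ed mulrA IHn -mulrA -exprSr.
  have [n qn0] := nq.
  case: d0; apply: (@division_corner_nilpotent e _ n) => //.
  by rewrite -qne qn0 mul0r.
have [w0 [[ew0 w0e] w0l lw0]] := dive l cl l0.
pose u := f * w0.
have [el le] := cl.
have efw0 : e * f * w0 = e by rewrite -ew0 mulrA.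
have eu : e * u = e by rewrite /u mulrA.
have fu : f * u = u by rewrite /u mulrA ff.
have ue : u * e = u by rewrite /u -mulrA w0e.
have fe : f * e = u * l.
  apply/eqP; rewrite -subr_eq0 /u -mulrA -mulrBr; apply/eqP/f_inj.
  by rewrite mulrBr (mulrA _ w0) efw0 el subrr.
clearbody u l.
have qu : q * u = d - u by rewrite qE fu -[in d * u]de -mulrA eu de.
have qe : q * e = d - u * l by rewrite qE de fe.
(* With coefficients from the corner acting on the right, [q] maps [u] to [u * D - w * d] and [w] to
   [u * m], where [D = d - e]. *)
pose w := u - e; pose m := l - e.
have ew : e * w = 0 by rewrite /w mulrBr eu ee subrr.
have we : w * e = w by rewrite /w mulrBl ue ee.
have qw : q * w = u * m.
  by rewrite /w /m !mulrBr qu qe ue opprB [LHS]addrC addrA subrK.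
pose D := d - e.
have quD : q * u = u * D - w * d.
  by rewrite qu /D /w mulrBr mulrBl ue ed opprB [RHS]addrC addrA subrK.
have cD : corner e D by rewrite /corner /D mulrBl mulrBr ed de ee.
have cm : corner e m by rewrite /corner /m mulrBl mulrBr el le ee.
have DE : D = d - e by [].
clearbody w m D; have [n qn0] := nq.
(* For [m = 0] the action of [q] is triangular with diagonal entry [D], so [D] is nilpotent and
   [d = e]. *)
have [m0|m0] := pselect (m = 0).
  have qnu : exists x, q ^+ n * u = u * D ^+ n + w * x.
    elim: (n) => [|k [x IHk]].
      by exists 0; rewrite mul1r mulr1 mulr0 addr0.
    exists (- (d * D ^+ k)); rewrite exprS -mulrA IHk mulrDr !mulrA qw m0.
    by rewrite mulr0 mul0r addr0 quD mulrBl exprS mulrN !mulrA.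
  have [x qnuE] := qnu.
  have eDn : e * D ^+ n = 0.
    have := congr1 (fun y => e * y) qnuE.
    by rewrite qn0 mul0r mulr0 mulrDr !mulrA eu ew mul0r addr0.
  apply/eqP; rewrite -subr_eq0 -DE; apply/eqP.
  exact: division_corner_nilpotent eDn.
(* Now [m] and [d] are invertible, so [q] maps the span of [u] and [w] onto itself; being nilpotent,
   it forces [u = 0]. *)
have [m' [_ _ mm']] := dive m cm m0.
have [d' [_ _ dd']] := dive d cd d0.
have uE : q * w * m' = u by rewrite qw -mulrA mm' ue.
have wE : q * w * m' * D * d' - q * u * d' = w.
  by rewrite uE quD mulrBl opprB addrC subrK -mulrA dd' we.
have surj k a b : exists a' b', u * a + w * b = q ^+ k * (u * a' + w * b').
  elim: k a b => [|k IHk] a b; first by exists a, b; rewrite mul1r.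
  have [a1 [b1 ->]] := IHk a b.
  exists (- (d' * b1)), (m' * a1 + m' * D * d' * b1).
  rewrite exprSr -mulrA; congr (_ * _).
  by rewrite -[in LHS]uE -{2}wE !mulrDr !mulrN !mulrA mulrBl addrA [RHS]addrC.
have [a [b ueE]] := surj n e 0.
have u0 : u = 0 by rewrite qn0 mul0r mulr0 addr0 ue in ueE.
by case: d0; rewrite -ed -eu u0 mulr0 mul0r.
Qed.

End SemisimpleRings.

(** * Companion blocks over the field with two elements *)

Section CornersOfOrderTwo.
Variable S : pzRingType.
Implicit Types (a e f h q w x y z : S).

(** For an idempotent [e <> 0], the corner [e S e] is then the field with two elements. *)
Definition corner_F2 e := forall z, corner e z -> z = 0 \/ z = e.

Definition left_span (t : nat -> S) n :=
  [set y | exists a : nat -> S, y = \sum_(i < n) a i * t i].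

Lemma corner_F2_addrr e z :
  idempotent e -> corner_F2 e -> e * z = z -> z + z = 0.
Proof.
move=> ee F2e ez; suff e2 : e + e = 0 by rewrite -ez -mulrDl e2 mul0r.
have [||] := F2e (e + e); rewrite // /corner ?mulrDl ?mulrDr ?ee //.
move/eqP; rewrite -[X in _ == X]addr0 (inj_eq (addrI e)) => /eqP ->.
by rewrite addr0.
Qed.

(** If [z a z = z], then [z a e] lies in the corner, and it is nonzero because [z = (z a e) z]. *)
Lemma corner_F2_functional e z :
  semisimple_ring S -> idempotent e -> corner_F2 e ->
  e * z = z -> z <> 0 -> exists2 s, s * e = s & z * s = e.
Proof.
move=> ssS ee F2e ez z0; have [a zaz] := semisimple_regular z ssS.
exists (a * e); first by rewrite -mulrA ee.
have [||//] := F2e (z * (a * e)).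
  by rewrite /corner mulrA ez -!mulrA ee.
by move=> zae0; case: z0; rewrite -zaz -{2}ez !mulrA -(mulrA z) zae0 mul0r.
Qed.

(** A Gram-Schmidt argument: [1 - g] removes from [t n] its part in the span of the earlier rows. By
    independence the remainder is nonzero and has a dual column, along which the old columns are
    then corrected. *)
Lemma dual_system e (t : nat -> S) n : semisimple_ring S ->
    idempotent e -> corner_F2 e -> (forall i, e * t i = t i) ->
    (forall i, (i < n)%N -> ~ left_span t i (t i)) ->
  exists s : nat -> S, (forall i, s i * e = s i) /\
    forall i j, (i < n)%N -> (j < n)%N -> t i * s j = if i == j then e else 0.
Proof.
move=> ssS ee F2e et; elim: n => [|n IHn] indep.
  by exists (fun=> 0); split=> // i; rewrite mul0r.
have [i ltin|s [se ts]] := IHn; first by apply: indep; rewrite ltnS ltnW.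
pose g := \sum_(i < n) s i * t i.
have tg i : (i < n)%N -> t i * g = t i.
  move=> ltin; rewrite /g mulr_sumr (bigD1 (Ordinal ltin)) //= big1.
    by rewrite mulrA ts // eqxx et addr0.
  move=> j /negbTE neji; rewrite mulrA ts // eq_sym.
  by rewrite -[_ == _]/(j == Ordinal ltin) neji mul0r.
have [||w we zw] := @corner_F2_functional e (t n * (1 - g)) ssS ee F2e.
- by rewrite mulrA et.
- rewrite mulrBr mulr1 => /eqP; rewrite subr_eq0 => /eqP tng.
  apply: (indep n) => //; exists (fun i => t n * s i).
  by rewrite {1}tng mulr_sumr; apply: eq_bigr => i _; rewrite mulrA.
pose s' := (1 - g) * w.
have s'e : s' * e = s' by rewrite -mulrA we.
have ts' i : (i < n)%N -> t i * s' = 0.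
  by move=> ltin; rewrite mulrA mulrBr mulr1 tg // subrr mul0r.
have tns' : t n * s' = e by rewrite mulrA.
exists (fun j => if j == n then s' else s j - s' * (t n * s j)).
split=> [j|i j].
  by case: ifP => // _; rewrite mulrBl se -!mulrA se.
rewrite !ltnS => lein lejn; case: (eqVneq j n) => [->|nejn].
  case: (eqVneq i n) => [->|nein] //.
  by rewrite ts' // ltn_neqAle nein.
have ltjn : (j < n)%N by rewrite ltn_neqAle nejn.
rewrite mulrBr mulrA; case: (eqVneq i n) => [->|nein].
  by rewrite tns' mulrA et subrr (eq_sym n) (negbTE nejn).
have ltin : (i < n)%N by rewrite ltn_neqAle nein.
by rewrite ts' // mul0r subr0 ts.
Qed.

(* The elements [t i] and [s i] play the roles of a basis of row vectors and of
   the dual basis of column vectors, on which [x] acts as a companion matrix. *)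
Section Companion.
Variables (e x : S) (t s : nat -> S) (m : nat).
Hypotheses (ee : idempotent e) (F2e : corner_F2 e).
Hypothesis tx : forall i, t i * x = t i.+1.
Hypothesis et : forall i, e * t i = t i.
Hypothesis ts : forall i j, (i <= m)%N -> (j <= m)%N ->
  t i * s j = if i == j then e else 0.

(** When [e] fixes the [p i], right multiplication by [A p] sends the row [t i] to [p i] for
    [i <= m]; thus [g] projects onto the span of these rows. *)
Let A (p : nat -> S) := \sum_(i < m.+1) s i * p i.
Let g := A t.

Let tA p i : (i <= m)%N -> e * p i = p i -> t i * A p = p i.
Proof.
rewrite -ltnS => ltim ep; rewrite /A mulr_sumr (bigD1 (Ordinal ltim)) //= big1.
  by rewrite mulrA ts // eqxx ep addr0.
move=> j /negbTE neji; rewrite mulrA ts // -1?ltnS // eq_sym.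
by rewrite -[_ == _]/(j == Ordinal ltim) neji mul0r.
Qed.

Let gA p : (forall i, e * p i = p i) -> g * A p = A p.
Proof.
move=> ep; rewrite {1}/g {1}/A mulr_suml; apply: eq_bigr => i _.
by rewrite -mulrA tA // -ltnS.
Qed.

Let Ag p : (forall i, (i <= m)%N -> p i * g = p i) -> A p * g = A p.
Proof.
move=> pg; rewrite {1}/A mulr_suml; apply: eq_bigr => i _.
by rewrite -mulrA pg // -ltnS.
Qed.

Let tg i : (i <= m)%N -> t i * g = t i.
Proof. by move=> leim; apply: tA. Qed.

Lemma companion_unit_idempotent : idempotent g.
Proof. exact: gA. Qed.

(** Testing on the rows suffices, since [A p = g * A p]; producing this [g] costs one more
    factor. *)
Let nilpotentA p N : (forall i, e * p i = p i) ->
  (forall i, (i <= m)%N -> t i * A p ^+ N = 0) -> nilpotent (A p).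
Proof.
move=> ep tpN; exists N.+1; rewrite exprS -{1}gA // -mulrA -exprS exprSr mulrA.
suff -> : g * A p ^+ N = 0 by rewrite mul0r.
rewrite /g {1}/A mulr_suml big1 // => i _.
by rewrite -mulrA tpN ?mulr0 // -ltnS.
Qed.

Let gx : g * x = A (fun i => t i.+1).
Proof.
by rewrite /g /A mulr_suml; apply: eq_bigr => i _; rewrite -mulrA tx.
Qed.

Lemma companion_nilpotent : t m.+1 = 0 ->
  [/\ nilpotent (g * x), g * (g * x) = g * x & g * x * g = g * x].
Proof.
move=> tm0; split; last first.
- rewrite gx; apply: Ag => i; rewrite leq_eqVlt => /predU1P[->|/tg //].
  by rewrite tm0 mul0r.
- by rewrite gx gA.
rewrite gx; apply: (@nilpotentA _ m.+1) => // i leim.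
have tiE j : (i + j <= m.+1)%N -> t i * A (fun i => t i.+1) ^+ j = t (i + j)%N.
  elim: j => [|j IHj] leijm; first by rewrite mulr1 addn0.
  rewrite addnS in leijm; rewrite exprSr mulrA IHj ?tA ?addnS //.
  exact: ltnW.
rewrite -(subnK (leqW leim)) exprD mulrA tiE subnKC // ?leqW //.
by rewrite tm0 mul0r.
Qed.

Variables (k : nat) (c : pred nat).
Hypothesis lekm : (k <= m)%N.
Let r := \sum_(i < k | c i) t i.
Hypothesis tSm : t m.+1 = t k + r.

(* In the basis [t 0, ..., t k, t k.+1 - t k, ..., t m - t m.-1], the element
   [x] acts as the sum of the idempotent [E] and of the nilpotent shift [Q]. *)
Let p i := if (i < k)%N then 0 else if (i < m)%N then t k else t m + r.
Let E := A p.
Let Q := g * x - E.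

Lemma companion_nil_clean : [/\ idempotent E, nilpotent Q,
  g * E = E /\ E * g = E & g * Q = Q /\ Q * g = Q].
Proof.
have er : e * r = r by rewrite /r mulr_sumr; apply: eq_bigr => i _.
have rg : r * g = r.
  rewrite /r mulr_suml; apply: eq_bigr => i _; apply: tg.
  exact: leq_trans (ltnW (ltn_ord i)) lekm.
have ep i : e * p i = p i.
  rewrite /p; case: ifP => _; first by rewrite mulr0.
  by case: ifP => _; rewrite ?mulrDr ?et ?er.
have pg i : p i * g = p i.
  rewrite /p; case: ifP => _; first by rewrite mul0r.
  by case: ifP => _; rewrite ?mulrDl ?tg ?rg.
have tE i : (i <= m)%N -> t i * E = p i by move=> leim; apply: tA.
have gE : g * E = E by apply: gA.
have Eg : E * g = E by apply: Ag.
have gxg : g * x * g = g * x.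
  rewrite gx; apply: Ag => i; rewrite leq_eqVlt => /predU1P[->|/tg //].
  by rewrite tSm mulrDl tg ?rg.
have gQ : g * Q = Q by rewrite /Q mulrBr gE mulrA companion_unit_idempotent.
have Qg : Q * g = Q by rewrite /Q mulrBl gxg Eg.
split=> //.
  have rE : r * E = 0.
    rewrite /r mulr_suml big1 // => i _; rewrite tE ?/p ?ltn_ord //.
    exact: leq_trans (ltnW (ltn_ord i)) lekm.
  rewrite /idempotent {1}/E /A mulr_suml; apply: eq_bigr => i _.
  rewrite -mulrA; congr (_ * _); have := ltn_ord i; rewrite ltnS => leim.
  rewrite {1}/p; case: ifP => ltik; first by rewrite mul0r /p ltik.
  case: ifP => ltim.
    have ltkm : (k < m)%N by apply: leq_ltn_trans ltim; rewrite leqNgt ltik.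
    by rewrite tE // /p ltnn ltkm ltik ltim.
  rewrite mulrDl rE addr0 tE // /p ltnNge lekm /= ltnn ltik ltim //.
pose p' i := t i.+1 - p i.
have QE : Q = A p'.
  by rewrite /Q gx /E /A -sumrB; apply: eq_bigr => i _; rewrite mulrBr.
have ep' i : e * p' i = p' i by rewrite mulrBr et ep.
have tQ i : (i <= m)%N -> t i * Q = p' i by move=> leim; rewrite QE; apply: tA.
(* The iterates of [t 0] under [Q] run through the basis described above. *)
have t0Qlow i : (i <= k)%N -> t 0 * Q ^+ i = t i.
  elim: i => [|i IHi] leik; first by rewrite mulr1.
  rewrite exprSr mulrA IHi ?(ltnW leik) // tQ; last first.
    exact: leq_trans (ltnW leik) lekm.
  by rewrite /p' /p leik subr0.
have t0Qhigh i : (k <= i)%N -> (i < m)%N -> t 0 * Q ^+ i.+1 = t i.+1 - t i.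
  elim: i => [|i IHi] leki ltim.
    move: leki; rewrite leqn0 => /eqP k0.
    by rewrite expr1 tQ // /p' /p k0 ltnn ltim.
  move: leki; rewrite leq_eqVlt => /predU1P[kE|ltki].
    rewrite -kE in ltim *.
    by rewrite exprSr mulrA t0Qlow // tQ // /p' /p ltnn ltim.
  have leki : (k <= i)%N by rewrite -ltnS.
  have ltim' := ltnW ltim; have leim := ltnW ltim'.
  rewrite exprSr mulrA IHi // mulrBl !tQ // /p' /p (ltnNge i k) (ltnNge i.+1 k).
  by rewrite leki (leqW leki) ltim ltim' /= opprB addrA subrK.
have t0Q : t 0 * Q ^+ m.+1 = 0.
  rewrite exprSr mulrA; have tmQ : t m * Q = t k - t m.
    rewrite tQ // /p' /p ltnNge lekm ltnn /= tSm.
    by rewrite opprD addrACA subrr addr0.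
  move: (lekm); rewrite leq_eqVlt => /predU1P[kE|ltkm].
    by rewrite t0Qlow ?kE // tmQ kE subrr.
  have mE : m = m.-1.+1 by rewrite prednK // (leq_trans _ ltkm).
  have m1k : (m.-1 < k)%N = false by rewrite ltnNge -ltnS -mE ltkm.
  have m1m : (m.-1 < m)%N by rewrite ltn_predL (leq_trans _ ltkm).
  have tm1Q : t m.-1 * Q = t m - t k.
    by rewrite tQ ?leq_pred // /p' /p m1k m1m -mE.
  have -> : t 0 * Q ^+ m = t m - t m.-1.
    by have := t0Qhigh m.-1; rewrite -mE; apply; rewrite // -ltnS -mE.
  (* What remains is [t k - t m] taken twice, which vanishes in characteristic two. *)
  rewrite mulrBl tmQ tm1Q opprB.
  apply: (@corner_F2_addrr e) => //; by rewrite mulrBr !et.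
rewrite QE; apply: (@nilpotentA _ m.+1) => // i; rewrite -QE.
have Qt0 j : t 0 * Q ^+ j * Q ^+ m.+1 = 0.
  by rewrite -mulrA -exprD addnC exprD mulrA t0Q mul0r.
(* Each [t i] is a sum of iterates of [t 0], all killed by [Q ^+ m.+1]. *)
elim: i => [|i IHi] leim; first by rewrite -(mulr1 (t 0)) -[1](expr0 Q) Qt0.
have [ltki|leik] := leqP i.+1 k; first by rewrite -t0Qlow ?Qt0.
by rewrite -(subrK (t i) (t i.+1)) mulrDl -t0Qhigh // Qt0 IHi ?addr0 // ltnW.
Qed.

End Companion.
End CornersOfOrderTwo.

(** * Nil-clean semisimple rings *)

Section NilCleanSemisimple.
Variable S : pzRingType.
Implicit Types (a e f g h q w x y z : S).

Lemma left_span_ideal (t : nat -> S) : left_ideal (\bigcup_n left_span t n).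
Proof.
split=> [|x y [n _ [a ->]] [n' _ [b ->]]|z x [n _ [a ->]]].
- by exists 0%N => //; exists (fun=> 0); rewrite big_ord0.
- exists (n + n')%N => //.
  exists (fun i => (if (i < n)%N then a i else 0) +
                   (if (i < n')%N then b i else 0)).
  have widen k k' (d : nat -> S) : (k <= k')%N ->
      \sum_(i < k) d i * t i =
      \sum_(i < k') (if (i < k)%N then d i else 0) * t i.
    move=> lekk'; rewrite (big_ord_widen _ (fun i => d i * t i) lekk').
    rewrite big_mkcond /=.
    by apply: eq_bigr => i _; case: ifP; rewrite ?mul0r.
  rewrite (widen n (n + n')%N) ?leq_addr // (widen n' (n + n')%N) ?leq_addl //.
  by rewrite -big_split /=; apply: eq_bigr => i _; rewrite mulrDl.
exists n => //; exists (fun i => z * a i); rewrite mulr_sumr.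
by apply: eq_bigr => i _; rewrite mulrA.
Qed.

(** The union of the spans is a left ideal whose right unit already lies in one of them, at some
    stage [n]; multiplying [t n] by it gives the relation. *)
Lemma left_span_stationary (t : nat -> S) : semisimple_ring S ->
  exists n, left_span t n (t n).
Proof.
move=> ssS; have idU := left_span_ideal t.
have [_ [n _ [a ->]] tU] := semisimple_right_unit ssS idU.
exists n, (fun i => t n * a i); rewrite -[LHS]tU.
  by rewrite mulr_sumr; apply: eq_bigr => i _; rewrite mulrA.
exists n.+1 => //; exists (fun i => if i == n then 1 else 0).
rewrite big_ord_recr /= eqxx mul1r big1 ?add0r // => i _.
by rewrite ltn_eqF ?mul0r.
Qed.

Lemma big_ord_last (t : nat -> S) (c : pred nat) n :
  \sum_(i < n | c i) t i = 0 \/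
  exists2 k, (k < n)%N & \sum_(i < n | c i) t i = t k + \sum_(i < k | c i) t i.
Proof.
elim: n => [|n IHn]; first by left; rewrite big_ord0.
have sumE : \sum_(i < n.+1 | c i) t i =
            \sum_(i < n | c i) t i + (if c n then t n else 0).
  by rewrite big_mkcond big_ord_recr /= -big_mkcond.
rewrite sumE; case: (c n); first by right; exists n; rewrite 1?addrC.
rewrite addr0; case: IHn => [->|[k ltkn ->]]; [by left | right].
by exists k => //; apply: ltnW.
Qed.

(** Powers of a block triangular element carry the powers of [x] and [y] on the diagonal. Once these
    vanish, only a part [w] in [h S g] is left, and [w * w = 0]. *)
Lemma nilpotent_block g h x y z :
  idempotent g -> idempotent h -> g * h = 0 -> h * g = 0 ->
  corner g x -> corner h y -> h * z = z -> z * g = z ->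
  nilpotent x -> nilpotent y -> nilpotent (x + y + z).
Proof.
move=> gg hh gh hg [gx xg] [hy yh] hz zg [m xm0] [n yn0].
have pow k : exists w, [/\ h * w = w, w * g = w &
    (x + y + z) ^+ k.+1 = x ^+ k.+1 + y ^+ k.+1 + w].
  elim: k => [|k [w [hw wg IHk]]]; first by exists z.
  exists (y ^+ k.+1 * z + w * x); split.
  - by rewrite mulrDr !mulrA hw exprS mulrA hy.
  - by rewrite mulrDl -!mulrA zg xg.
  have xg' : x ^+ k.+1 = x ^+ k.+1 * g by rewrite exprSr -mulrA xg.
  have yh' : y ^+ k.+1 = y ^+ k.+1 * h by rewrite exprSr -mulrA yh.
  have gy : g * y = 0 by rewrite -hy mulrA gh mul0r.
  have gz : g * z = 0 by rewrite -hz mulrA gh mul0r.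
  have hx : h * x = 0 by rewrite -gx mulrA hg mul0r.
  have xy : x ^+ k.+1 * y = 0 by rewrite xg' -mulrA gy mulr0.
  have xz : x ^+ k.+1 * z = 0 by rewrite xg' -mulrA gz mulr0.
  have yx : y ^+ k.+1 * x = 0 by rewrite yh' -mulrA hx mulr0.
  have wy : w * y = 0 by rewrite -wg -mulrA gy mulr0.
  have wz : w * z = 0 by rewrite -wg -mulrA gz mulr0.
  rewrite exprSr IHk !mulrDl !mulrDr xy xz yx wy wz !addr0 add0r.
  by rewrite -!exprSr !addrA.
have [w [hw wg E]] := pow (m + n)%N.
exists ((m + n).+1 * 2)%N; rewrite exprM E -addnS exprD xm0 mul0r.
rewrite addnS -addSn exprD yn0 mulr0 !add0r expr2.
by rewrite -{1}wg -{2}hw -mulrA (mulrA g) gh mul0r mulr0.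
Qed.

Lemma corner_F2_nil_clean_block h e x : semisimple_ring S -> idempotent h ->
    corner h x -> idempotent e -> corner h e -> e <> 0 -> corner_F2 e ->
  exists g E Q, [/\ idempotent g /\ corner h g, g <> 0,
    g * x * g = g * x /\ g * x = E + Q,
    idempotent E /\ nilpotent Q & corner g E /\ corner g Q].
Proof.
move=> ssS hh [hx xh] ee [he eh] e0 F2e.
pose t i := e * x ^+ i.
have tx i : t i * x = t i.+1 by rewrite /t -mulrA exprSr.
have et i : e * t i = t i by rewrite /t mulrA ee.
have th i : t i * h = t i.
  by case: i => [|i]; rewrite /t ?mulr1 // exprSr -!mulrA xh.
have [n [tn indep]] : exists n, left_span t n (t n) /\
    forall i, (i < n)%N -> ~ left_span t i (t i).
  have ex_n : exists n, `[< left_span t n (t n) >].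
    by have [n tn] := left_span_stationary t ssS; exists n; apply/asboolP.
  case: (ex_minnP ex_n) => n /asboolP tn min_n; exists n; split=> // i ltin.
  by move/asboolP/min_n; rewrite leqNgt ltin.
have [s' [s'e ts']] := dual_system ssS ee F2e et indep.
case: n tn ts' {indep} => [|m] tm ts'.
  by case: tm => a; rewrite big_ord0 /t mulr1.
(* This puts [g] in the corner of [h] and keeps the duality, since [t i * h = t i]. *)
pose s i := h * s' i.
have ts i j : (i <= m)%N -> (j <= m)%N -> t i * s j = if i == j then e else 0.
  by move=> leim lejm; rewrite /s mulrA th ts'.
pose g := \sum_(i < m.+1) s i * t i.
have gg : idempotent g := companion_unit_idempotent et ts.
have cg : corner h g.
  split; rewrite /g ?mulr_sumr ?mulr_suml; apply: eq_bigr => i _.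
    by rewrite /s !mulrA hh.
  by rewrite -mulrA th.
have g0 : g <> 0.
  move=> g0; apply: e0; have : t 0 * g = t 0.
    rewrite /g big_ord_recl mulrDr mulrA ts //= et mulr_sumr.
    rewrite big1 ?addr0 // => i _.
    by rewrite mulrA ts // mul0r.
  by rewrite g0 mulr0 /t mulr1.
(* Each [e * a i * e] is [0] or [e], so the dependence relation just selects a subset of the
   rows. *)
have [c tmE] : exists c : pred nat, t m.+1 = \sum_(i < m.+1 | c i) t i.
  have [a tmE] := tm; exists (fun i => `[< e * a i * e = e >]).
  rewrite -et tmE mulr_sumr [RHS]big_mkcond; apply: eq_bigr => i _.
  have -> : e * (a i * t i) = e * a i * e * t i by rewrite -{1}et !mulrA.
  case: asboolP => [->|]; first exact: et.
  have [|->|//] := F2e (e * a i * e); last by rewrite mul0r.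
  by rewrite /corner !mulrA ee -!mulrA ee.
have [t0|[k lekm tkE]] := big_ord_last t c m.+1.
  rewrite t0 in tmE.
  have [nQ gQ Qg] := companion_nilpotent tx et ts tmE.
  exists g, 0, (g * x); split=> //; first by split; rewrite // add0r.
    by split=> //; apply: mulr0.
  by split; split; rewrite ?mulr0 ?mul0r.
rewrite tkE in tmE.
have [EE nQ [gE Eg] [gQ Qg]] := companion_nil_clean ee F2e tx et ts lekm tmE.
set E := (X in idempotent X) in EE nQ gE Eg gQ Qg.
exists g, E, (g * x - E); split=> //.
have gxE : g * x = E + (g * x - E) by rewrite addrC subrK.
by split=> //; rewrite gxE mulrDl Eg Qg.
Qed.

Lemma corner_F2_nil_clean : semisimple_artinian_ring S ->
  (forall h, idempotent h -> h <> 0 ->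
     exists e, [/\ idempotent e, corner h e, e <> 0 & corner_F2 e]) ->
  nil_clean_ring S.
Proof.
move=> [ssS artS] exF2.
pose P h := forall x, corner h x -> exists E Q,
  [/\ idempotent E /\ corner h E, nilpotent Q /\ corner h Q & x = E + Q].
suff main : forall h, idempotent h -> P h.
  move=> x; have [||E [Q [[EE _] [nQ _] xE]]] := main 1 _ x; first exact: mulr1.
    by split; rewrite ?mul1r ?mulr1.
  by exists E, Q.
apply: (@idempotent_ind _ P artS) => h hh IHh x cx.
have [h0|h0] := pselect (h = 0).
  exists 0, 0; have [<- _] := cx; rewrite h0 mul0r addr0; split=> //; split.
  - exact: mulr0.
  - by split; rewrite mulr0.
  - by exists 1%N; rewrite expr1.
  - by split; rewrite mulr0.
have [e [ee he e0 F2e]] := exF2 h hh h0.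
have [g [E1 [Q1 [[gg [hg gh]] g0 [gxg gxE] [EE1 nQ1]
      [[gE1 E1g] [gQ1 Q1g]]]]]] :=
  corner_F2_nil_clean_block ssS hh cx ee he e0 F2e.
pose h' := h - g.
have [hx xh] := cx.
have h'h' : idempotent h'.
  by rewrite /idempotent /h' mulrBl !mulrBr hh hg gh gg subrr subr0.
have h'h : h' * h = h' by rewrite /h' mulrBl hh gh.
have hh' : h * h' = h' by rewrite /h' mulrBr hh hg.
have gh' : g * h' = 0 by rewrite /h' mulrBr gh gg subrr.
have h'g : h' * g = 0 by rewrite /h' mulrBl hg gg subrr.
have h'neh : h' <> h.
  move/eqP; rewrite /h' -[X in _ == X]addr0 (inj_eq (addrI h)) oppr_eq0 => /eqP.
  exact: g0.
have h'E : h' + g = h by rewrite subrK.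
clearbody h'; have [|E2 [Q2 [[EE2 [h'E2 E2h']] [nQ2 [h'Q2 Q2h']] xE2]]] :=
  IHh h' h'h' h'h hh' h'neh (h' * x * h').
  by split; rewrite ?mulrA ?h'h' // -mulrA h'h'.
(* Since [g x h' = 0], the only off-diagonal part of [x] is [h' x g], which joins the nilpotent
   summand. *)
exists (E1 + E2), (Q1 + Q2 + h' * x * g).
have E12 : E1 * E2 = 0 by rewrite -E1g -h'E2 -mulrA (mulrA g) gh' mul0r mulr0.
have E21 : E2 * E1 = 0 by rewrite -E2h' -gE1 -mulrA (mulrA h') h'g mul0r mulr0.
have corner_g z : g * z = z -> h * z = z by move=> <-; rewrite mulrA hg.
have corner_g' z : z * g = z -> z * h = z by move=> <-; rewrite -mulrA gh.
have corner_h' z : h' * z = z -> h * z = z by move=> <-; rewrite mulrA hh'.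
have corner_h'' z : z * h' = z -> z * h = z by move=> <-; rewrite -mulrA h'h.
split.
- split.
    by rewrite /idempotent mulrDl !mulrDr EE1 EE2 E12 E21 addr0 add0r.
  split; rewrite ?mulrDr ?mulrDl.
    by rewrite (corner_g E1) ?(corner_h' E2).
  by rewrite (corner_g' E1) ?(corner_h'' E2).
- split.
    by apply: (@nilpotent_block g h') => //; rewrite ?mulrA ?h'h' // -mulrA gg.
  split; rewrite ?mulrDr ?mulrDl.
    by rewrite (corner_g Q1) ?(corner_h' Q2) // !mulrA hh'.
  by rewrite (corner_g' Q1) ?(corner_h'' Q2) // -(mulrA _ g) gh.
rewrite addrA addrACA -gxE -xE2 -addrA -mulrDr h'E -mulrA xh -mulrDl.
by rewrite (addrC g) h'E hx.
Qed.

(** A minimal nonzero idempotent below [h] works: if [z w z = z] in its corner with [z <> 0], then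
    [z w] and [w z] are nonzero idempotents below it, hence equal to it. *)
Lemma division_corner_exists h :
  semisimple_artinian_ring S -> idempotent h -> h <> 0 ->
  exists e, [/\ idempotent e, corner h e, e <> 0 & division_corner e].
Proof.
move=> [ssS artS] hh; move: h hh.
pose P h := h <> 0 ->
  exists e, [/\ idempotent e, corner h e, e <> 0 & division_corner e].
apply: (@idempotent_ind _ P artS) => h hh IHh h0.
apply: contrapT => nex.
have prim f : idempotent f -> corner h f -> f <> 0 -> f = h.
  move=> ff [hf fh] f0; apply: contrapT => fneh.
  have [e [ee [fe ef] e0 dive]] := IHh f ff fh hf fneh f0.
  apply: nex; exists e; split=> //.
  by split; [rewrite -fe mulrA hf | rewrite -ef -mulrA fh].
apply: nex; exists h; split=> // z [hz zh] z0.
have [a zaz] := semisimple_regular z ssS; pose w := h * a * h.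
have zwz : z * w * z = z by rewrite /w !mulrA zh -!mulrA hz mulrA.
have cw : corner h w by rewrite /corner /w !mulrA hh -!mulrA hh.
have [hw wh] := cw; exists w; split=> //; apply: prim.
- by rewrite /idempotent -mulrA (mulrA z) zwz.
- by rewrite /corner mulrA hw -mulrA zh.
- by move=> wz0; apply: z0; rewrite -zwz -mulrA wz0 mulr0.
- by rewrite /idempotent mulrA zwz.
- by rewrite /corner mulrA hz -mulrA wh.
- by move=> zw0; apply: z0; rewrite -zwz zw0 mul0r.
Qed.

Lemma GNC_semisimple : semisimple_artinian_ring S -> GNC_ring S ->
  ((1 : S) <> 0 /\ forall a, a <> 0 -> exists b, b * a = 1) \/ nil_clean_ring S.
Proof.
move=> ssS gncS.
have [div1|ndiv1] := pselect ((1 : S) <> 0 /\ division_corner (1 : S)).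
  have [one_neq0 div1'] := div1; left; split=> // a a0.
  have [|b [_ ba _]] := div1' a _ a0; last by exists b.
  by split; rewrite ?mul1r ?mulr1.
right; apply: corner_F2_nil_clean => // h hh h0.
have [e [ee he e0 dive]] := division_corner_exists ssS hh h0.
exists e; split=> // z cz; apply: (nil_clean_division_corner ee dive cz).
(* If [z] had an inverse [y], then [e = e z y = z y = 1], which is the excluded case. *)
apply: gncS => -[y [_ zy]]; apply: ndiv1; suff <- : e = 1 by [].
by rewrite -[LHS]mulr1 -zy mulrA cz.1.
Qed.

End NilCleanSemisimple.

(** * Matrices over the field with two elements, and the equivalence *)

(** Take [e = u v] of rank one, with [v] a nonzero row of [h] and [u] the column of [h] at the
    position of an entry [1] of [v], so that [v u = 1]. Then [z = u (v z u) v] depends on a single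
    scalar. *)
Lemma matrix_F2_corner n (h : 'M['Z_2]_n) : idempotent h -> h <> 0 ->
  exists e, [/\ idempotent e, corner h e, e <> 0 & corner_F2 e].
Proof.
move=> hh h0.
have [i hi0] : exists i, row i h <> 0.
  apply: contrapT => nex; apply: h0; apply/row_matrixP => i; rewrite row0.
  by apply: contrapT => hi0; apply: nex; exists i.
pose v := row i h.
have vh : v *m h = v by rewrite /v -row_mul; congr (row i _); exact: hh.
have [j vj0] : exists j, v 0 j <> 0.
  apply: contrapT => nex; apply: hi0; apply/rowP => j; rewrite [RHS]mxE.
  by apply: contrapT => vj0; apply: nex; exists j.
have F2 (b : 'Z_2) : b = 0 \/ b = 1.
  by case: b => [[|[|b]] // b2]; [left | right]; apply: val_inj.
have vj1 : v 0 j = 1 by case: (F2 (v 0 j)).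
pose u : 'cV['Z_2]_n := h *m delta_mx j 0.
have vu : v *m u = 1%:M.
  by rewrite mulmxA vh; apply/matrixP => a b; rewrite !ord1 -colE mxE vj1 mxE.
have hu : h *m u = u by rewrite mulmxA [h *m h]hh.
exists (u *m v); split.
- by rewrite /idempotent [LHS]mulmxA -(mulmxA u) vu mulmx1.
- by split; [rewrite [LHS]mulmxA hu | rewrite -[LHS]mulmxA vh].
- move=> uv0; have : v *m (u *m v) = 0 by rewrite uv0 mulmx0.
  by rewrite mulmxA vu mul1mx.
move=> z [ez ze]; have -> : z = u *m (v *m z *m u) *m v.
  by rewrite -{1}ze -{1}ez; rewrite -![_ * _]/(_ *m _) !mulmxA.
rewrite [v *m z *m u]mx11_scalar.
case: (F2 ((v *m z *m u) 0 0)) => ->; [left|right].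
  by rewrite raddf0 mulmx0 mul0mx.
by rewrite mulmx1.
Qed.

Lemma jquot_matrix_nil_clean (R : pzRingType) n : semilocal_ring R ->
  ring_isomorphic (jquot R) 'M['Z_2]_n -> nil_clean_ring (jquot R).
Proof.
move=> ssS [f f_bij]; have f_inj := bij_inj f_bij; have [f' _ f'K] := f_bij.
apply: corner_F2_nil_clean => // h hh h0.
have [||e [ee [he eh] e0 F2e]] := @matrix_F2_corner n (f h).
- by rewrite /idempotent -rmorphM hh.
- by rewrite -(rmorph0 f) => /f_inj.
exists (f' e); split.
- by apply: f_inj; rewrite rmorphM /= f'K.
- by split; apply: f_inj; rewrite rmorphM /= f'K.
- by move=> f'e0; apply: e0; rewrite -(f'K e) f'e0 rmorph0.
move=> z [ez ze]; have [|fz0|fze] := F2e (f z).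
- by rewrite /corner -(f'K e) -!rmorphM ez ze.
- by left; apply: f_inj; rewrite fz0 rmorph0.
by right; apply: f_inj; rewrite fze f'K.
Qed.

Theorem theorem2p17 (R : pzRingType) (hR : semilocal_ring R) :
  GNC_ring R <->
  [\/ local_ring R /\ nil_set (@jacobson_radical R),
      nil_set (@jacobson_radical R) /\
        (exists n : nat, (1 <= n)%N /\ ring_isomorphic (jquot R) 'M['Z_2]_n)
    | nil_clean_ring R].
Proof.
split=> [gncR|[[locR nilJ]|[nilJ [n [_ isoS]]]|ncR]].
- have nilJ := GNC_ring_nil_jacobson gncR.
  have [[one_neq0 divS]|ncS] := GNC_semisimple hR (GNC_ring_jquot gncR).
    by constructor 1; split=> //; apply: division_jquot_local.
  by constructor 3; apply: nil_clean_ring_lift.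
- exact: local_ring_GNC.
- move=> x _; apply: (nil_clean_ring_lift nilJ).
  exact: jquot_matrix_nil_clean isoS.
- by move=> x _; apply: ncR.
Qed.
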